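(* Let $\sigma$ be a generalized singular value of $(A,B)$, let $(\sigma,y)$ be a simple eigenpair of $(\widehat A,\widehat B)$ and let $(\frac1\sigma,z)$ be a simple eigenpair of $(\widetilde B,\widetilde A)$. Let their approximations $(\widehat\sigma,\widehat y)$ and $(\frac{1}{\widetilde\sigma},\widetilde z)$ be exact eigenpairs of the perturbed matrix pairs $(\widehat A+\widehat E,\widehat B+\widehat F)$ and $(\widetilde B+\widetilde F,\widetilde A+\widetilde E)$, respectively, where for some small $\epsilon>0$ the perturbations satisfy $$\|\widehat E\|\le\|\widehat A\|\epsilon,\quad \|\widehat F\|\le\|\widehat B\|\epsilon,\quad \|\widetilde F\|\le\|\widetilde B\|\epsilon,\quad \|\widetilde E\|\le\|\widetilde A\|\epsilon.$$ Assume that $\widehat y$ and $\widetilde z$ are decomposed in the unnormalized form $\widehat y=y+s$ and $\widetilde z=z+t$ with $y^T\widehat B s=0$ and $z^T\widetilde A t=0$. Then $$\chi(\widehat\sigma,\sigma)\le\frac{\|y\|^2(1+\delta_1)}{\sqrt{(y^T\widehat Ay)^2+(y^T\widehat By)^2}}\sqrt{\|\widehat E\|^2+\|\widehat F\|^2},$$ $$\chi(\widetilde\sigma,\sigma)\le\frac{\|z\|^2(1+\delta_2)}{\sqrt{(z^T\widetilde Az)^2+(z^T\widetilde Bz)^2}}\sqrt{\|\widetilde E\|^2+\|\widetilde F\|^2},$$ where $\delta_1=\frac{\|s\|}{\|y\|}$ and $\delta_2=\frac{\|t\|}{\|z\|}$.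
   Context: $\|\cdot\|$ is the 2-norm of a vector or matrix. $A\in\mathbb{R}^{m\times n}$ ($m\ge n$) and $B\in\mathbb{R}^{p\times n}$ ($p\ge n$) have full column rank $n$. The GSVD of $(A,B)$ is $A=UCX^{-1}$, $B=VSX^{-1}$ with $C=\mathrm{diag}\{\alpha_1,\dots,\alpha_n\}$, $S=\mathrm{diag}\{\beta_1,\dots,\beta_n\}$, $\alpha_i,\beta_i>0$, $\alpha_i^2+\beta_i^2=1$, $X\in\mathbb{R}^{n\times n}$ nonsingular, and $U\in\mathbb{R}^{m\times n}$, $V\in\mathbb{R}^{p\times n}$ with orthonormal columns. The generalized singular values are $\sigma_i=\alpha_i/\beta_i$. Define the symmetric matrices $$\widehat A=\begin{bmatrix}0&A\\ A^T&0\end{bmatrix},\ \widehat B=\begin{bmatrix}I_m&0\\ 0&B^TB\end{bmatrix},\qquad \widetilde B=\begin{bmatrix}0&B\\ B^T&0\end{bmatrix},\ \widetilde A=\begin{bmatrix}I_p&0\\ 0&A^TA\end{bmatrix}.$$ $(\mu,w)$ is an eigenpair of a matrix pair $(M,N)$ if $Mw=\mu Nw$ with $w\ne0$. The nonzero eigenvalues of $(\widehat A,\widehat B)$ are $\pm\sigma_i$ and those of $(\widetilde B,\widetilde A)$ are $\pm1/\sigma_i$. All matrices, eigenvalues and vectors considered are real, and $\widetilde\sigma\neq0$. The chordal distance is $\chi(a,b)=\frac{|a-b|}{\sqrt{1+a^2}\sqrt{1+b^2}}$. *)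

(* Defs.v *)
From mathcomp Require Import all_boot all_order all_algebra.
From mathcomp Require Import all_classical all_reals.

Set Implicit Arguments.
Unset Strict Implicit.
Unset Printing Implicit Defensive.

Import Order.TTheory GRing.Theory Num.Theory.

Local Open Scope classical_set_scope.
Local Open Scope ring_scope.

(* MathComp-Analysis's own norm on matrices is the max norm, so the 2-norms
   are defined here. *)
Definition vnorm2 (R : realType) (n : nat) (v : 'cV[R]_n) : R :=
  Num.sqrt (\sum_(i < n) v i 0 ^+ 2).

(* The unit ball rather than the unit sphere, so that the set below is nonempty
   for n = 0 as well; the values agree. *)
Definition mnorm2 (R : realType) (m n : nat) (M : 'M[R]_(m, n)) : R :=
  sup [set vnorm2 (M *m v) | v in [set v : 'cV[R]_n | vnorm2 v <= 1]].

Definition bilin (R : realType) (n : nat) (u : 'cV[R]_n) (M : 'M[R]_n)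
    (v : 'cV[R]_n) : R :=
  (u^T *m M *m v) 0 0.

Definition chordal (R : realType) (a b : R) : R :=
  `|a - b| / (Num.sqrt (1 + a ^+ 2) * Num.sqrt (1 + b ^+ 2)).

Definition eigenpair (R : realType) (n : nat) (M N : 'M[R]_n) (mu : R)
    (w : 'cV[R]_n) : Prop :=
  M *m w = mu *: (N *m w) /\ w <> 0.

Definition pencil_poly (R : realType) (n : nat) (M N : 'M[R]_n) : {poly R} :=
  \det (map_mx polyC M - 'X *: map_mx polyC N).

(* Simplicity is algebraic: mu is a simple root of det(M - lambda N). *)
Definition simple_eigenpair (R : realType) (n : nat) (M N : 'M[R]_n) (mu : R)
    (w : 'cV[R]_n) : Prop :=
  eigenpair M N mu w /\ mup mu (pencil_poly M N) = 1%N.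

Definition is_gsvd (R : realType) (m p n : nat)
    (A : 'M[R]_(m, n)) (B : 'M[R]_(p, n))
    (U : 'M[R]_(m, n)) (V : 'M[R]_(p, n)) (X : 'M[R]_n)
    (alpha beta : 'rV[R]_n) : Prop :=
  A = U *m diag_mx alpha *m invmx X /\
  B = V *m diag_mx beta *m invmx X /\
  (forall i, 0 < alpha 0 i) /\
  (forall i, 0 < beta 0 i) /\
  (forall i, alpha 0 i ^+ 2 + beta 0 i ^+ 2 = 1) /\
  X \in unitmx /\
  U^T *m U = 1%:M /\
  V^T *m V = 1%:M.

Definition generalized_singular_value (R : realType) (m p n : nat)
    (A : 'M[R]_(m, n)) (B : 'M[R]_(p, n)) (sigma : R) : Prop :=
  exists U V X alpha beta,
    is_gsvd A B U V X alpha beta /\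
    exists i, sigma = alpha 0 i / beta 0 i.

(* With A : m x n and B : p x n, the pair (hat A, hat B) is
   (aug A, gram m B) and the pair (tilde B, tilde A) is (aug B, gram p A). *)
Definition aug (R : realType) (m n : nat) (M : 'M[R]_(m, n)) : 'M[R]_(m + n) :=
  block_mx 0 M M^T 0.

Definition gram (R : realType) (k p n : nat) (M : 'M[R]_(p, n)) :
    'M[R]_(k + n) :=
  block_mx 1%:M 0 0 (M^T *m M).

(* Main.v *)
Require Import Defs.
From mathcomp Require Import all_boot all_order all_algebra.
From mathcomp Require Import all_classical all_reals.
From mathcomp Require Import ring lra.

Set Implicit Arguments.
Unset Strict Implicit.
Unset Printing Implicit Defensive.

Import Order.TTheory GRing.Theory Num.Theory.

Local Open Scope ring_scope.

(** Both inequalities are instances of one bound for a symmetric pair [(M, N)]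
    with an eigenpair [(mu, y)] such that [y^T N y <> 0].  Multiplying the
    perturbed equation [(M + E) (y + s) = nu (N + F) (y + s)] by [y^T] on the
    left kills [s] in the unperturbed part: [y^T N s] is zero by orthogonality,
    and so is [y^T M s] since [y^T M = mu y^T N] by symmetry.  What remains is
    [(mu - nu) y^T N y = y^T (nu F - E) (y + s)].  The right-hand side is at
    most [|y| (|y| + |s|) (|nu| |F| + |E|)], and the Cauchy-Schwarz inequality
    in the plane splits the last factor as
    [sqrt (1 + nu^2) sqrt (|E|^2 + |F|^2)].  Since [y^T M y = mu y^T N y], one
    has [sqrt ((y^T M y)^2 + (y^T N y)^2) = sqrt (1 + mu^2) |y^T N y|], so
    dividing yields exactly the chordal distance
    ([chordal_perturbation]).

    The pairs of the theorem qualify because [gram k M] is positive definite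
    when [M] has full column rank ([bilin_gram_gt0]).  The second pair has
    eigenvalues [1 / sigma], which is harmless since the chordal distance is
    invariant under inversion ([chordal_inv]). *)

(** * The Euclidean norm and the operator norm *)

Lemma cauchy_schwarz_sum (R : realType) (I : finType) (a b : I -> R) :
  (\sum_i a i * b i) ^+ 2 <= (\sum_i a i ^+ 2) * (\sum_i b i ^+ 2).
Proof.
set P := \sum_i a i * b i; set SA := \sum_i a i ^+ 2.
set SB := \sum_i b i ^+ 2.
have SB_ge0 : 0 <= SB by apply: sumr_ge0 => i _; rewrite sqr_ge0.
(* Up to scaling, the residual of the projection of a onto b. *)
have : 0 <= \sum_i (SB * a i - P * b i) ^+ 2.
  by apply: sumr_ge0 => i _; rewrite sqr_ge0.
have -> : \sum_i (SB * a i - P * b i) ^+ 2 = SB * (SA * SB - P ^+ 2).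
  rewrite (eq_bigr (fun i => SB ^+ 2 * a i ^+ 2 +
    (- 2 * SB * P * (a i * b i) + P ^+ 2 * b i ^+ 2))) => [|i _]; last by ring.
  by rewrite !big_split -!mulr_sumr /= -/SA -/SB -/P; ring.
move: SB_ge0; rewrite le_eqVlt => /predU1P[SB0 _|SB_gt0].
  have b0 i : b i = 0.
    have /eqP := esym SB0; rewrite psumr_eq0 => [|j _]; last exact: sqr_ge0.
    by move/allP/(_ i (mem_index_enum i)); rewrite sqrf_eq0 => /eqP.
  have -> : P = 0 by apply: big1 => i _; rewrite b0 mulr0.
  by rewrite -SB0 expr0n mulr0.
by rewrite pmulr_rge0 // subr_ge0.
Qed.

Section Norms.
Variable R : realType.

Lemma vnorm2_ge0 n (v : 'cV[R]_n) : 0 <= vnorm2 v.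
Proof. exact: sqrtr_ge0. Qed.

Lemma vnorm2_sqr n (v : 'cV[R]_n) : vnorm2 v ^+ 2 = \sum_i v i 0 ^+ 2.
Proof. by rewrite sqr_sqrtr // sumr_ge0 // => i _; rewrite sqr_ge0. Qed.

Lemma vnorm2_gt0 n (v : 'cV[R]_n) : v != 0 -> 0 < vnorm2 v.
Proof.
move=> v_neq0; rewrite lt_neqAle vnorm2_ge0 andbT eq_sym.
apply: contra v_neq0 => /eqP v0; apply/eqP/matrixP => i j; rewrite ord1 mxE.
have /eqP := vnorm2_sqr v; rewrite v0 expr0n eq_sym psumr_eq0 => [|k _].
  by move/allP/(_ i (mem_index_enum i)); rewrite sqrf_eq0 => /eqP.
exact: sqr_ge0.
Qed.

Lemma vnorm20 n : vnorm2 (0 : 'cV[R]_n) = 0.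
Proof.
by rewrite /vnorm2 big1 ?sqrtr0 // => i _; rewrite mxE expr0n.
Qed.

Lemma vnorm2Z n (c : R) (v : 'cV[R]_n) : vnorm2 (c *: v) = `|c| * vnorm2 v.
Proof.
apply/eqP; rewrite -(eqrXn2 (n := 2)) ?mulr_ge0 ?vnorm2_ge0 //.
rewrite exprMn !vnorm2_sqr real_normK ?num_real // mulr_sumr.
by apply/eqP/eq_bigr => i _; rewrite mxE exprMn.
Qed.

Lemma bilinD n (u : 'cV[R]_n) (M : 'M[R]_n) (v w : 'cV[R]_n) :
  bilin u M (v + w) = bilin u M v + bilin u M w.
Proof. by rewrite /bilin mulmxDr mxE. Qed.

Lemma bilinDm n (u v : 'cV[R]_n) (M N : 'M[R]_n) :
  bilin u (M + N) v = bilin u M v + bilin u N v.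
Proof. by rewrite /bilin mulmxDr mulmxDl mxE. Qed.

Lemma cauchy_schwarz n (u v : 'cV[R]_n) :
  `|(u^T *m v) 0 0| <= vnorm2 u * vnorm2 v.
Proof.
rewrite -ler_sqr ?nnegrE ?mulr_ge0 ?vnorm2_ge0 //.
rewrite real_normK ?num_real // exprMn !vnorm2_sqr mxE.
under eq_bigr => i _ do rewrite mxE.
exact: cauchy_schwarz_sum.
Qed.

Lemma vnorm2D n (u v : 'cV[R]_n) : vnorm2 (u + v) <= vnorm2 u + vnorm2 v.
Proof.
rewrite -ler_sqr ?nnegrE ?addr_ge0 ?vnorm2_ge0 // sqrrD !vnorm2_sqr.
have -> : \sum_i (u + v) i 0 ^+ 2 =
    \sum_i u i 0 ^+ 2 + (u^T *m v) 0 0 *+ 2 + \sum_i v i 0 ^+ 2.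
  rewrite mxE -sumrMnl -!big_split /=.
  by apply: eq_bigr => i _; rewrite !mxE sqrrD.
rewrite lerD2r lerD2l ler_wMn2r //.
exact: le_trans (ler_norm _) (cauchy_schwarz u v).
Qed.

(** This makes the set whose supremum is the operator norm bounded above, so
    that the supremum is an upper bound rather than the default value of
    [sup].  Any finite constant would do; the Frobenius norm comes from
    Cauchy-Schwarz applied to each row. *)
Lemma vnorm2_mulmx_frobenius m n (M : 'M[R]_(m, n)) (v : 'cV[R]_n) :
  vnorm2 (M *m v) <= Num.sqrt (\sum_i \sum_j M i j ^+ 2) * vnorm2 v.
Proof.
rewrite -ler_sqr ?nnegrE ?mulr_ge0 ?sqrtr_ge0 ?vnorm2_ge0 //.
have frob_ge0 : 0 <= \sum_i \sum_j M i j ^+ 2.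
  by do 2![apply: sumr_ge0 => ? _]; rewrite sqr_ge0.
rewrite exprMn !vnorm2_sqr sqr_sqrtr // mulr_suml; apply: ler_sum => i _; rewrite mxE.
exact: cauchy_schwarz_sum.
Qed.

Lemma vnorm2_mulmx_ball m n (M : 'M[R]_(m, n)) (v : 'cV[R]_n) :
  vnorm2 v <= 1 -> vnorm2 (M *m v) <= mnorm2 M.
Proof.
move=> v_le1; apply: ub_le_sup; last by exists v.
exists (Num.sqrt (\sum_i \sum_j M i j ^+ 2)) => _ [w w_le1 <-].
apply: le_trans (vnorm2_mulmx_frobenius M w) _.
by rewrite ler_piMr ?sqrtr_ge0.
Qed.

Lemma mnorm2_ge0 m n (M : 'M[R]_(m, n)) : 0 <= mnorm2 M.
Proof.
by rewrite -(vnorm20 m) -(mulmx0 1 M) vnorm2_mulmx_ball // vnorm20.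
Qed.

Lemma vnorm2_mulmx m n (M : 'M[R]_(m, n)) (v : 'cV[R]_n) :
  vnorm2 (M *m v) <= mnorm2 M * vnorm2 v.
Proof.
have [->|/vnorm2_gt0 v_gt0] := eqVneq v 0.
  by rewrite mulmx0 !vnorm20 mulr0.
have norm_inv : `|(vnorm2 v)^-1| = (vnorm2 v)^-1.
  by rewrite ger0_norm // invr_ge0 ltW.
rewrite -ler_pdivrMr // mulrC -norm_inv -vnorm2Z scalemxAr.
by rewrite vnorm2_mulmx_ball // vnorm2Z norm_inv mulVf ?gt_eqF.
Qed.

Lemma norm_bilin n (u v : 'cV[R]_n) (M : 'M[R]_n) :
  `|bilin u M v| <= vnorm2 u * mnorm2 M * vnorm2 v.
Proof.
rewrite /bilin -mulmxA -mulrA; apply: le_trans (cauchy_schwarz _ _) _.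
by rewrite ler_wpM2l ?vnorm2_ge0 ?vnorm2_mulmx.
Qed.

End Norms.

(** * Perturbation of an eigenvalue of a symmetric pair *)

Section Perturbation.
Variable R : realType.

Lemma sqrt_1Dsqr_gt0 (a : R) : 0 < Num.sqrt (1 + a ^+ 2).
Proof. by rewrite sqrtr_gt0 ltr_pwDl ?sqr_ge0. Qed.

Lemma cauchy_schwarz2 (a b c : R) :
  b + `|a| * c <= Num.sqrt (1 + a ^+ 2) * Num.sqrt (b ^+ 2 + c ^+ 2).
Proof.
rewrite -sqrtrM ?addr_ge0 ?sqr_ge0 //.
apply: le_trans (ler_norm _) _; rewrite -sqrtr_sqr ler_wsqrtr //.
have := sqr_ge0 (c - `|a| * b); rewrite -(real_normK (num_real a)).
nra.
Qed.

Lemma chordal_perturbation n (M N E F : 'M[R]_n) (mu nu : R)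
    (y s : 'cV[R]_n) :
  M^T = M -> N^T = N -> M *m y = mu *: (N *m y) -> bilin y N y != 0 ->
  bilin y N s = 0 -> (M + E) *m (y + s) = nu *: ((N + F) *m (y + s)) ->
  chordal nu mu <=
    vnorm2 y ^+ 2 * (1 + vnorm2 s / vnorm2 y) /
      Num.sqrt (bilin y M y ^+ 2 + bilin y N y ^+ 2) *
    Num.sqrt (mnorm2 E ^+ 2 + mnorm2 F ^+ 2).
Proof.
move=> symM symN eig_y yNy_neq0 yNs0 eig_pert.
have y_gt0 : 0 < vnorm2 y.
  apply: vnorm2_gt0; apply: contra_neq yNy_neq0 => ->.
  by rewrite /bilin mulmx0 mxE.
have yM v : bilin y M v = mu * bilin y N v.
  rewrite /bilin -symM -trmx_mul eig_y linearZ /= trmx_mul symN.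
  by rewrite -scalemxAl mxE.
(* Here s drops out of the unperturbed terms. *)
have residual : (mu - nu) * bilin y N y =
    nu * bilin y F (y + s) - bilin y E (y + s).
  have : bilin y (M + E) (y + s) = nu * bilin y (N + F) (y + s).
    by rewrite /bilin -!mulmxA eig_pert -scalemxAr mxE.
  by rewrite !bilinDm yM !(bilinD _ N) yNs0 addr0; lra.
set b := bilin y N y in yNy_neq0 residual *.
have denom : Num.sqrt (bilin y M y ^+ 2 + b ^+ 2) =
    Num.sqrt (1 + mu ^+ 2) * `|b|.
  rewrite yM -/b -sqrtr_sqr -sqrtrM ?addr_ge0 ?sqr_ge0 //.
  by congr Num.sqrt; ring.
have bound : `|nu - mu| * `|b| <= vnorm2 y * (vnorm2 y + vnorm2 s) *
    (Num.sqrt (1 + nu ^+ 2) * Num.sqrt (mnorm2 E ^+ 2 + mnorm2 F ^+ 2)).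
  rewrite distrC -normrM residual.
  have Eb := norm_bilin y (y + s) E; have Fb := norm_bilin y (y + s) F.
  apply: le_trans (ler_normB _ _) _; rewrite normrM.
  apply: (@le_trans _ _ (vnorm2 y * vnorm2 (y + s) *
                         (mnorm2 E + `|nu| * mnorm2 F))).
    have := ler_wpM2l (normr_ge0 nu) Fb; move: Eb; lra.
  apply: ler_pM; last exact: cauchy_schwarz2.
  - by rewrite mulr_ge0 ?vnorm2_ge0.
  - by rewrite addr_ge0 ?mulr_ge0 ?mnorm2_ge0.
  - by rewrite ler_wpM2l ?vnorm2_ge0 ?vnorm2D.
have b_gt0 : 0 < `|b| by rewrite normr_gt0.
have nu_gt0 := sqrt_1Dsqr_gt0 nu; have mu_gt0 := sqrt_1Dsqr_gt0 mu.
rewrite denom /chordal ler_pdivrMr ?mulr_gt0 //.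
rewrite -(ler_pM2r b_gt0); apply: le_trans bound _.
rewrite le_eqVlt; apply/orP; left; apply/eqP; field.
by rewrite !gt_eqF.
Qed.

(** The chordal distance is the sine of the angle between the lines of slopes
    [a] and [b], and inverting slopes is a reflection in the diagonal. *)
Lemma chordal_inv (a b : R) : a != 0 -> b != 0 ->
  chordal (1 / a) (1 / b) = chordal a b.
Proof.
move=> a_neq0 b_neq0.
have sqrt_inv c : c != 0 ->
    Num.sqrt (1 + (1 / c) ^+ 2) = Num.sqrt (1 + c ^+ 2) / `|c|.
  move=> c_neq0; rewrite -[`|c|]sqrtr_sqr -sqrtrV ?sqr_ge0 //.
  rewrite -sqrtrM ?addr_ge0 ?sqr_ge0 //.
  by congr Num.sqrt; field.
rewrite /chordal !sqrt_inv //.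
have -> : 1 / a - 1 / b = (b - a) / (a * b).
  by field; rewrite a_neq0 b_neq0.
rewrite normf_div normrM (distrC b a).
move: (sqrt_1Dsqr_gt0 a) (sqrt_1Dsqr_gt0 b) => /lt0r_neq0 + /lt0r_neq0.
move: a_neq0 b_neq0; rewrite -[a == 0]normr_eq0 -[b == 0]normr_eq0.
move: (Num.sqrt _) (Num.sqrt _) `|a| `|b| `|a - b| => ra rb na nb d.
move=> na_neq0 nb_neq0 rb_neq0 ra_neq0; field.
by rewrite ra_neq0 rb_neq0 nb_neq0.
Qed.

End Perturbation.

(** * The augmented pairs *)

Section Augmented.
Variable R : realType.

Lemma tr_aug m n (M : 'M[R]_(m, n)) : (aug M)^T = aug M.
Proof. by rewrite /aug tr_block_mx !trmx0 trmxK. Qed.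

Lemma tr_gram k p n (M : 'M[R]_(p, n)) : (gram k M)^T = gram k M.
Proof. by rewrite /gram tr_block_mx !trmx0 trmx1 trmx_mul trmxK. Qed.

Lemma bilin_gram k p n (M : 'M[R]_(p, n)) (y : 'cV[R]_(k + n)) :
  bilin y (gram k M) y =
    vnorm2 (usubmx y) ^+ 2 + vnorm2 (M *m dsubmx y) ^+ 2.
Proof.
have dotE l (v : 'cV[R]_l) : (v^T *m v) 0 0 = vnorm2 v ^+ 2.
  by rewrite vnorm2_sqr mxE; apply: eq_bigr => i _; rewrite mxE expr2.
rewrite /bilin -[y in LHS]vsubmxK tr_col_mx mul_row_block mul_row_col.
rewrite !mulmx0 mulmx1 addr0 add0r mxE dotE.
by rewrite -[in RHS](dotE _ (M *m _)) trmx_mul !mulmxA.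
Qed.

(** The quadratic form is the sum of squares of [bilin_gram]; if its first term
    vanishes, [y] has a nonzero lower half, which [M] does not kill. *)
Lemma bilin_gram_gt0 k p n (M : 'M[R]_(p, n)) (y : 'cV[R]_(k + n)) :
  \rank M = n -> y <> 0 -> 0 < bilin y (gram k M) y.
Proof.
move=> rankM /eqP y_neq0; rewrite bilin_gram.
have [u0|u_neq0] := eqVneq (usubmx y) 0; last first.
  by rewrite ltr_pwDl ?sqr_ge0 // exprn_gt0 // vnorm2_gt0.
rewrite ltr_wpDl ?sqr_ge0 // exprn_gt0 // vnorm2_gt0 //.
apply: contra y_neq0 => /eqP Mv0.
have freeMT : row_free M^T by rewrite /row_free mxrank_tr rankM.
have /eqP := congr1 trmx Mv0.
rewrite trmx_mul trmx0 mulmx_free_eq0 // => /eqP vT0.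
by rewrite -[y]vsubmxK u0 -[dsubmx y]trmxK vT0 trmx0 col_mx0.
Qed.

End Augmented.

Lemma gsv_gt0 (R : realType) (m p n : nat)
    (A : 'M[R]_(m, n)) (B : 'M[R]_(p, n)) (sigma : R) :
  generalized_singular_value A B sigma -> 0 < sigma.
Proof.
move=> [U [V [X [alpha [beta [[_ [_ [a0 [b0 _]]]] [i ->]]]]]]].
by rewrite divr_gt0.
Qed.

Theorem theorem2p2 (R : realType) (m p n : nat)
    (A : 'M[R]_(m, n)) (B : 'M[R]_(p, n))
    (hmn : (n <= m)%N) (hpn : (n <= p)%N)
    (hA : \rank A = n) (hB : \rank B = n)
    (sigma : R) (hsigma : generalized_singular_value A B sigma) :
  let Ahat := aug A in
  let Bhat := gram m B in
  let Btil := aug B in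
  let Atil := gram p A in
  forall (y : 'cV[R]_(m + n)) (z : 'cV[R]_(p + n))
    (hy : simple_eigenpair Ahat Bhat sigma y)
    (hz : simple_eigenpair Btil Atil (1 / sigma) z)
    (sigmahat sigmatil : R) (hsigmatil : sigmatil <> 0)
    (yhat : 'cV[R]_(m + n)) (ztil : 'cV[R]_(p + n))
    (Ehat Fhat : 'M[R]_(m + n)) (Etil Ftil : 'M[R]_(p + n))
    (hyhat : eigenpair (Ahat + Ehat) (Bhat + Fhat) sigmahat yhat)
    (hztil : eigenpair (Btil + Ftil) (Atil + Etil) (1 / sigmatil) ztil)
    (epsilon : R) (hepsilon : 0 < epsilon)
    (hEhat : mnorm2 Ehat <= mnorm2 Ahat * epsilon)
    (hFhat : mnorm2 Fhat <= mnorm2 Bhat * epsilon)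
    (hFtil : mnorm2 Ftil <= mnorm2 Btil * epsilon)
    (hEtil : mnorm2 Etil <= mnorm2 Atil * epsilon)
    (s : 'cV[R]_(m + n)) (t : 'cV[R]_(p + n))
    (hs : yhat = y + s) (ht : ztil = z + t)
    (hys : bilin y Bhat s = 0) (hzt : bilin z Atil t = 0),
  let delta1 := vnorm2 s / vnorm2 y in
  let delta2 := vnorm2 t / vnorm2 z in
  chordal sigmahat sigma <=
    vnorm2 y ^+ 2 * (1 + delta1) /
      Num.sqrt (bilin y Ahat y ^+ 2 + bilin y Bhat y ^+ 2) *
    Num.sqrt (mnorm2 Ehat ^+ 2 + mnorm2 Fhat ^+ 2)
  /\
  chordal sigmatil sigma <=
    vnorm2 z ^+ 2 * (1 + delta2) /
      Num.sqrt (bilin z Atil z ^+ 2 + bilin z Btil z ^+ 2) *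
    Num.sqrt (mnorm2 Etil ^+ 2 + mnorm2 Ftil ^+ 2).
Proof.
move=> Ahat Bhat Btil Atil y z [[eig_y y_neq0] _] [[eig_z z_neq0] _].
move=> sigmahat sigmatil sigmatil_neq0 yhat ztil Ehat Fhat Etil Ftil.
move=> [eig_yhat _] [eig_ztil _] epsilon _ _ _ _ _ s t def_yhat def_ztil.
move=> yBs0 zAt0 /=.
rewrite {}def_yhat in eig_yhat; rewrite {}def_ztil in eig_ztil.
split.
  apply: (chordal_perturbation (tr_aug A) (tr_gram m B)) => //.
  by rewrite gt_eqF ?bilin_gram_gt0.
rewrite -chordal_inv; [|exact/eqP|by rewrite gt_eqF ?(gsv_gt0 hsigma)].
rewrite (addrC (bilin z Atil z ^+ 2)) (addrC (mnorm2 Etil ^+ 2)).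
apply: (chordal_perturbation (tr_aug B) (tr_gram p A)) => //.
by rewrite gt_eqF ?bilin_gram_gt0.
Qed.
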